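(* Let $U$ be an $M\times M$ unitary, let $\mathrm{in}=(s_1,\dots,s_N)$ be distinct input modes each containing one photon, and let $P(t)$ be the ideal boson-sampling output distribution and $P_a(t)$ the distinguishable-particle distribution (defined in the context). Then $$\epsilon:=\tfrac12\sum_t|P(t)-P_a(t)|\le\frac12\sum_{(j_1,\dots,j_N)\in[M]^N}\ \sum_{\rho\in S_N\setminus\{\mathrm{Id}\}}\ \prod_{i=1}^N|U_{j_i,s_i}|\,|U_{j_i,s_{\rho(i)}}|=\frac12\sum_{\emptyset\neq\mathcal I_C\subseteq[N]}\ \sum_{\substack{\rho:\ \rho(i)\neq i\ \forall i\in\mathcal I_C\\ \rho(i)=i\ \forall i\notin\mathcal I_C}}\ \sum_{(j_1,\dots,j_N)}\prod_{i}|U_{j_i,s_i}||U_{j_i,s_{\rho(i)}}|,$$ and in particular $\epsilon\le\frac12\sum_{\emptyset\ne\mathcal I_C\subseteq[N]}\prod_{i\in\mathcal I_C}C_i$, where $C_i=\sum_{j=1}^M\sum_{l\neq i}|U_{j,s_i}||U_{j,s_l}|$.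
   Context: Output patterns are tuples $t=(t_1,\dots,t_M)$ of nonnegative integers summing to $N$, with $t!=\prod_it_i!$ and $\mathrm{out}$ the list of $N$ modes in which photons are detected (mode $m$ repeated $t_m$ times). The ideal probability is $P(t)=\frac1{t!}\big|\sum_{\sigma\in S_N}\prod_{j=1}^NU_{\mathrm{out}_{\sigma(j)},s_j}\big|^2$ and the distinguishable-particle probability is $P_a(t)=\frac1{t!}\sum_{\sigma\in S_N}\prod_{j=1}^N|U_{\mathrm{out}_{\sigma(j)},s_j}|^2$, which is the distribution of the occupation pattern obtained by independently sampling, for each $j$, a mode $m$ with probability $|U_{m,s_j}|^2$. *)

(* Defs.v *)
(* Complex amplitudes live in an arbitrary numClosedFieldType C
   (e.g. algC); norms `|z| are real elements of C, compared with the order of C. *)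
From mathcomp Require Import all_boot all_order all_algebra all_fingroup.
Set Implicit Arguments. Unset Strict Implicit. Unset Printing Implicit Defensive.
Import Order.TTheory GRing.Theory Num.Theory.
Local Open Scope ring_scope.

Section BosonSampling.
Variables (C : numClosedFieldType) (M N : nat).

Definition unitary (U : 'M[C]_M) : Prop :=
  U *m (map_mx Num.conj U)^T = 1%:M.

Definition pattern := {ffun 'I_M -> 'I_N.+1}.
Definition is_pattern (t : pattern) : bool := (\sum_(m < M) (t m : nat) == N)%N.

Definition tfact (t : pattern) : nat := (\prod_(m < M) (t m)`!)%N.

Definition out_seq (t : pattern) : seq 'I_M :=
  flatten [seq nseq (t m) m | m <- enum 'I_M].

(* out_k, k : 'I_N; the default (s k) is never used when t is a pattern *)
Definition out (s : 'I_N -> 'I_M) (t : pattern) (k : 'I_N) : 'I_M :=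
  nth (s k) (out_seq t) k.

Definition Pideal (U : 'M[C]_M) (s : 'I_N -> 'I_M) (t : pattern) : C :=
  ((tfact t)%:R)^-1 *
  `| \sum_(sigma : 'S_N) \prod_(j < N) U (out s t (sigma j)) (s j) | ^+ 2.

Definition Pdist (U : 'M[C]_M) (s : 'I_N -> 'I_M) (t : pattern) : C :=
  ((tfact t)%:R)^-1 *
  \sum_(sigma : 'S_N) \prod_(j < N) `| U (out s t (sigma j)) (s j) | ^+ 2.

Definition tvd (U : 'M[C]_M) (s : 'I_N -> 'I_M) : C :=
  2^-1 * \sum_(t : pattern | is_pattern t) `| Pideal U s t - Pdist U s t |.

Definition Ccoef (U : 'M[C]_M) (s : 'I_N -> 'I_M) (i : 'I_N) : C :=
  \sum_(j < M) \sum_(l < N | l != i) `| U j (s i) | * `| U j (s l) |.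

End BosonSampling.

(* Main.v *)
Require Import Defs.
From mathcomp Require Import all_boot all_order all_algebra all_fingroup.
Import Order.TTheory GRing.Theory Num.Theory.
Set Implicit Arguments. Unset Strict Implicit. Unset Printing Implicit Defensive.

(* The sequence out of a pattern t has occurrence counts t, so a
      sum over sigma of F (out \o sigma) equals t! times the sum of F over the
      maps j : 'I_N -> 'I_M of type t; summing over all patterns t then gives
      a sum over all maps j.
   3. One pattern.  Expanding |sum_sigma a_sigma|^2 - sum_sigma |a_sigma|^2 as
      the off-diagonal sum over pairs (sigma, tau), tau <> sigma, and
      reparametrising tau = rho^-1 sigma bounds |P(t) - P_a(t)|.  With 2. this
      is the first inequality; grouping rho by its support gives the equality.
   4. For rho with support I, the sum over j factorises into a product of
      column overlaps, with diagonal overlaps 1 by unitarity; it is one term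
      of the expansion of prod_(i in I) C_i, whose terms are all nonnegative. *)

Definition occ (n : nat) (T : eqType) (g : 'I_n -> T) (m : T) : nat :=
  \sum_(k < n) (g k == m).

Lemma occ_lift n (T : eqType) (g : 'I_n.+1 -> T) j m :
  occ g m = (g j == m) + occ (g \o lift j) m.
Proof. by rewrite /occ (bigD1_ord j). Qed.

Lemma occ_le n (T : eqType) (g : 'I_n -> T) m : occ g m <= n.
Proof.
rewrite /occ -[X in _ <= X]card_ord -sum1_card.
by apply: leq_sum => k _; case: (_ == _).
Qed.

Lemma sum_occ n (T : finType) (g : 'I_n -> T) : \sum_m occ g m = n.
Proof.
rewrite /occ exchange_big /= -[RHS]card_ord -sum1_card.
apply: eq_bigr => k _; rewrite (bigD1 (g k)) //= eqxx big1 // => m hm.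
by rewrite eq_sym (negbTE hm).
Qed.

Lemma occ_eq_lift n (T : finType) (g h : 'I_n.+1 -> T) j i :
  g j = h i ->
  [forall m, occ g m == occ h m] =
  [forall m, occ (g \o lift j) m == occ (h \o lift i) m].
Proof.
move=> ghji; apply: eq_forallb => m.
by rewrite (occ_lift g j) (occ_lift h i) ghji eqn_add2l.
Qed.

Lemma prod_fact_occ_lift n (T : finType) (h : 'I_n.+1 -> T) i :
  \prod_m (occ h m)`! = occ h (h i) * \prod_m (occ (h \o lift i) m)`!.
Proof.
rewrite [LHS](bigD1 (h i)) //= [in RHS](bigD1 (h i)) //= mulnA.
rewrite (occ_lift h i (h i)) eqxx add1n factS.
congr (_ * _); apply: eq_bigr => m hm.
by rewrite (occ_lift h i m) eq_sym (negbTE hm).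
Qed.

Lemma forall_lift n (P : pred 'I_n.+1) i0 :
  [forall i, P i] = P i0 && [forall k, P (lift i0 k)].
Proof.
apply/forallP/andP => [H|[H1 /forallP H2] i]; first by split => //; apply/forallP.
by case: (unliftP i0 i) => [k|] ->.
Qed.

Lemma big_perm_fix (R : Type) (idx : R) (op : Monoid.com_law idx) n i0 j0
    (F : 'S_n.+1 -> R) :
  \big[op/idx]_(s : 'S_n.+1 | s i0 == j0) F s =
  \big[op/idx]_(s : 'S_n) F (lift_perm i0 j0 s).
Proof.
rewrite (reindex (lift_perm i0 j0)); last first.
  pose ulsf i (s : 'S_n.+1) k := odflt k (unlift (s i) (s (lift i k))).
  have ulsfK i (s : 'S_n.+1) k: lift (s i) (ulsf i s k) = s (lift i k).
    rewrite /ulsf; have:= neq_lift i k.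
    by rewrite -(can_eq (permK s)) => /unlift_some[] ? ? ->.
  have inj_ulsf: injective (ulsf i0 _).
    move=> s; apply: can_inj (ulsf (s i0) s^-1%g) _ => k'.
    by rewrite {1}/ulsf ulsfK !permK liftK.
  exists (fun s => perm (inj_ulsf s)) => [s _ | s].
    by apply/permP=> k'; rewrite permE /ulsf lift_perm_lift lift_perm_id liftK.
  move/(s _ =P _) => si0; apply/permP=> k.
  case: (unliftP i0 k) => [k'|] ->; rewrite ?lift_perm_id //.
  by rewrite lift_perm_lift -si0 permE ulsfK.
by apply: eq_bigl => s; rewrite lift_perm_id eqxx.
Qed.

Lemma card_perm_match n (T : finType) (g h : 'I_n -> T) :
  \sum_(s : 'S_n | [forall i, g (s i) == h i]) 1 =
  if [forall m, occ g m == occ h m] then \prod_m (occ h m)`! else 0.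
Proof.
elim: n g h => [|n IH] g h.
  have occ0 (f : 'I_0 -> T) m : occ f m = 0 by rewrite /occ big_ord0.
  have -> : [forall m, occ g m == occ h m] by apply/forallP => m; rewrite !occ0.
  rewrite [RHS]big1 => [|m _]; last by rewrite occ0.
  rewrite (eq_bigl predT) => [|s]; last by apply/forallP => -[].
  by rewrite sum1_card card_Sn.
set P := \prod_m (occ (h \o lift ord0) m)`!.
have fix_first j0 :
    \sum_(s : 'S_n.+1 | [forall i, g (s i) == h i] && (s ord0 == j0)) 1 =
    (g j0 == h ord0) * (if [forall m, occ g m == occ h m] then P else 0).
  rewrite big_mkcondl big_perm_fix.
  under eq_bigr => s _.
    rewrite (forall_lift _ ord0) lift_perm_id.
    under eq_forallb => k do rewrite lift_perm_lift.
    over.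
  have [ghj0 | _] := eqP; last by rewrite big1.
  rewrite /= mul1n (occ_eq_lift ghj0) -IH [RHS]big_mkcond.
  by apply: eq_bigr.
rewrite (partition_big (fun s : 'S_n.+1 => s ord0) predT) //=.
rewrite (eq_bigr _ (fun j0 _ => fix_first j0)) -big_distrl /= -/(occ g (h ord0)).
case: ifP => [/forallP eq_occ|_]; last by rewrite muln0.
by rewrite (eqP (eq_occ _)) (prod_fact_occ_lift h ord0).
Qed.

Section Patterns.
Variables (M N : nat).

Lemma size_out_seq (t : pattern M N) : is_pattern t -> size (out_seq t) = N.
Proof.
move=> /eqP ht; rewrite /out_seq size_flatten /shape -map_comp sumnE big_map.
by rewrite big_enum /= -[X in _ = X]ht; apply: eq_bigr => m _; rewrite /= size_nseq.
Qed.

Lemma count_out_seq (t : pattern M N) m : count (pred1 m) (out_seq t) = t m.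
Proof.
rewrite /out_seq count_flatten -map_comp sumnE big_map big_enum /=.
rewrite (bigD1 m) //= count_nseq /= eqxx mul1n big1 ?addn0 // => m' hm'.
by rewrite count_nseq /= (negbTE hm').
Qed.

Lemma occ_out (s : 'I_N -> 'I_M) (t : pattern M N) m :
  is_pattern t -> occ (out s t) m = t m.
Proof.
move=> ht; rewrite -count_out_seq -sum1_count big_mkcond /=.
rewrite (big_nth m) size_out_seq // big_mkord /occ.
by apply: eq_bigr => k _; rewrite /out (set_nth_default m) ?size_out_seq.
Qed.

Lemma tfact_gt0 (t : pattern M N) : 0 < tfact t.
Proof. by apply: prodn_gt0 => m; apply: fact_gt0. Qed.

Definition pattern_of (j : {ffun 'I_N -> 'I_M}) : pattern M N :=
  [ffun m => inord (occ j m)].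

Lemma pattern_ofP (j : {ffun 'I_N -> 'I_M}) (t : pattern M N) :
  (is_pattern t && [forall m, occ j m == t m]) = (t == pattern_of j).
Proof.
have val_pattern_of m : (pattern_of j m : nat) = occ j m.
  by rewrite ffunE inordK // ltnS occ_le.
apply/andP/eqP => [[_ /forallP H]|->].
  by apply/ffunP => m; apply: val_inj; rewrite /= val_pattern_of (eqP (H m)).
split; last by apply/forallP => m; rewrite val_pattern_of.
by rewrite /is_pattern (eq_bigr _ (fun m _ => val_pattern_of m)) sum_occ.
Qed.

End Patterns.

Local Open Scope ring_scope.

Section SumsOverPatterns.
Variables (R : pzSemiRingType) (M N : nat).
Implicit Types (F : {ffun 'I_N -> 'I_M} -> R) (t : pattern M N).

Lemma sum_perm_out (s : 'I_N -> 'I_M) t F : is_pattern t ->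
  \sum_(sg : 'S_N) F [ffun i => out s t (sg i)] =
  (tfact t)%:R * \sum_(j : {ffun 'I_N -> 'I_M} | [forall m, occ j m == t m]) F j.
Proof.
move=> ht.
rewrite (partition_big (fun sg : 'S_N => [ffun i => out s t (sg i)]) predT) //=.
rewrite [in RHS]big_mkcond big_distrr /=; apply: eq_bigr => j _.
rewrite (eq_bigr (fun _ => 1 * F j)) => [|sg /eqP ->]; last by rewrite mul1r.
rewrite -big_distrl /= (eq_bigr (fun _ => 1%:R)) // -natr_sum.
have -> : (\sum_(sg : 'S_N | [ffun i => out s t (sg i)] == j) 1 =
           \sum_(sg : 'S_N | [forall i, out s t (sg i) == j i]) 1)%N.
  apply: eq_bigl => sg; apply/eqP/forallP => [<- i|H]; first by rewrite ffunE.
  by apply/ffunP => i; rewrite ffunE (eqP (H i)).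
rewrite card_perm_match.
under eq_forallb => m do rewrite occ_out // eq_sym.
case: ifP => [/forallP occ_jt|_]; last by rewrite mul0r mulr0.
by rewrite /tfact; congr (_%:R * _); apply: eq_bigr => m _; rewrite (eqP (occ_jt m)).
Qed.

(* Every map j has exactly one pattern. *)
Lemma sum_over_patterns F :
  \sum_(t : pattern M N | is_pattern t) \sum_(j : {ffun 'I_N -> 'I_M} | [forall m, occ j m == t m]) F j = \sum_j F j.
Proof.
rewrite (exchange_big_dep predT) //=; apply: eq_bigr => j _.
by rewrite (eq_bigl _ _ (pattern_ofP j)) big_pred1_eq.
Qed.

End SumsOverPatterns.

Section OnePattern.
Variables (C : numClosedFieldType) (M N : nat) (U : 'M[C]_M) (s : 'I_N -> 'I_M).

Definition pair_weight (j : 'I_N -> 'I_M) (rho : 'S_N) : C :=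
  \prod_i (`|U (j i) (s i)| * `|U (j i) (s (rho i))|).

(* The cross terms of |sum_sigma a_sigma|^2 attached to sigma, reparametrised
   by rho with tau = rho^-1 sigma. *)
Lemma sum_cross_terms (g : 'I_N -> 'I_M) (sg : 'S_N) :
  \sum_(tau : 'S_N | tau != sg)
     `|\prod_j U (g (sg j)) (s j)| * `|\prod_j U (g (tau j)) (s j)| =
  \sum_(rho : 'S_N | rho != 1%g) pair_weight [ffun i => g (sg i)] rho.
Proof.
have inj : injective (fun rho : 'S_N => (rho^-1 * sg)%g).
  by move=> x y /mulIg /invg_inj.
rewrite (reindex_inj inj) /=; apply: eq_big => [rho|rho _].
  congr negb; apply/eqP/eqP => [e|->]; last by rewrite invg1 mul1g.
  by apply: invg_inj; rewrite invg1; apply: (mulIg sg); rewrite mul1g.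
rewrite !normr_prod [X in _ * X](reindex_inj (@perm_inj _ rho)) -big_split /=.
by apply: eq_bigr => i _; rewrite permM permK ffunE.
Qed.

Lemma Pdiff_le (t : pattern M N) :
  `|Pideal U s t - Pdist U s t| <= (tfact t)%:R^-1 *
   \sum_(sg : 'S_N) \sum_(rho : 'S_N | rho != 1%g)
      pair_weight [ffun i => out s t (sg i)] rho.
Proof.
rewrite /Pideal /Pdist -mulrBr normrM ger0_norm ?invr_ge0 ?ler0n //.
apply: ler_wpM2l; first by rewrite invr_ge0 ler0n.
set a := fun sg : 'S_N => \prod_(j < N) U (out s t (sg j)) (s j).
have norm_a (sg : 'S_N) :
    \prod_(j < N) `|U (out s t (sg j)) (s j)| ^+ 2 = a sg * (a sg)^*.
  by rewrite prodrXl -normr_prod normCK.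
rewrite (eq_bigr _ (fun sg _ => norm_a sg)) normCK rmorph_sum mulr_suml -sumrB.
apply: le_trans (ler_norm_sum _ _ _) _; apply: ler_sum => sg _.
rewrite -sum_cross_terms mulr_sumr (bigD1 sg) //= /a addrAC subrr add0r.
apply: le_trans (ler_norm_sum _ _ _) _; apply: ler_sum => tau _.
by rewrite normrM norm_conjC.
Qed.

Lemma tvd_le_pair_weight :
  tvd U s <= 2^-1 * \sum_(j : {ffun 'I_N -> 'I_M})
                      \sum_(rho : 'S_N | rho != 1%g) pair_weight j rho.
Proof.
rewrite /tvd; apply: ler_wpM2l; first by rewrite invr_ge0 ler0n.
rewrite -sum_over_patterns; apply: ler_sum => t ht.
apply: (le_trans (Pdiff_le t)).
rewrite (sum_perm_out s (fun j => \sum_(rho : 'S_N | rho != 1%g) pair_weight j rho)) //.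
by rewrite mulrA mulVf ?mul1r // pnatr_eq0 -lt0n tfact_gt0.
Qed.

End OnePattern.

Lemma big_perm_by_support (R : Type) (idx : R) (op : Monoid.com_law idx) n
    (F : 'S_n -> R) :
  \big[op/idx]_(rho : 'S_n | rho != 1%g) F rho =
  \big[op/idx]_(I : {set 'I_n} | I != set0)
     \big[op/idx]_(rho : 'S_n | [forall i, (rho i != i) == (i \in I)]) F rho.
Proof.
rewrite (partition_big (fun rho : 'S_n => [set i | rho i != i]) (fun I => I != set0)).
  apply: eq_bigr => I hI; apply: eq_bigl => rho.
  apply/andP/forallP => [[_ /eqP <-] i | supp_rho]; first by rewrite inE.
  have eI : [set i | rho i != i] = I by apply/setP => i; rewrite inE (eqP (supp_rho i)).
  split; last by rewrite eI.
  apply: contraNneq hI => e; rewrite -eI; apply/eqP/setP => i.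
  by rewrite !inE e perm1 eqxx.
move=> rho; apply: contraNneq => e; apply/eqP/permP => i; rewrite perm1; apply/eqP.
by have := in_set0 i; rewrite -e inE; case: eqP.
Qed.

Lemma sum_inj_le (R : numDomainType) (T T' : finType) (P : pred T)
    (h : T -> T') (G : T' -> R) :
  {in P &, injective h} -> (forall y, 0 <= G y) ->
  \sum_(x | P x) G (h x) <= \sum_y G y.
Proof.
move=> inj_h G_ge0; rewrite [X in X <= _](eq_bigl (fun x => x \in P)) //.
rewrite -(big_imset G inj_h) /=.
rewrite [X in _ <= X](bigID (mem (h @: P))) /= lerDl.
by apply: sumr_ge0 => y _; apply: G_ge0.
Qed.

Section Overlaps.
Variables (C : numClosedFieldType) (M N : nat) (U : 'M[C]_M) (s : 'I_N -> 'I_M).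
Hypothesis unitaryU : unitary U.
Implicit Types (I : {set 'I_N}).

Lemma unitary_col_norm k : \sum_m `|U m k| ^+ 2 = 1.
Proof.
have := congr1 (fun A : 'M[C]_M => A k k) (mulmx1C unitaryU).
rewrite !mxE eqxx => col_k; apply: etrans col_k; apply: eq_bigr => m _.
by rewrite !mxE normCK mulrC.
Qed.

Definition overlap (i l : 'I_N) : C := \sum_m `|U m (s i)| * `|U m (s l)|.

Lemma overlap_ge0 i l : 0 <= overlap i l.
Proof. by apply: sumr_ge0 => m _; rewrite mulr_ge0. Qed.

Lemma overlap_diag i : overlap i i = 1.
Proof.
by rewrite -(unitary_col_norm (s i)); apply: eq_bigr => m _; rewrite expr2.
Qed.

Lemma sum_pair_weight_paths (rho : 'S_N) :
  \sum_(j : {ffun 'I_N -> 'I_M}) pair_weight U s j rho = \prod_i overlap i (rho i).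
Proof. by rewrite /overlap bigA_distr_bigA. Qed.

(* Factor i of the expansion of prod_(i in I) C_i: the overlaps with l <> i
   when i is in I, and the Kronecker delta at i otherwise. *)
Definition weight (I : {set 'I_N}) (i l : 'I_N) : C :=
  if i \in I then (l != i)%:R * overlap i l else (l == i)%:R.

Lemma weight_ge0 I i l : 0 <= weight I i l.
Proof. by rewrite /weight; case: ifP => _; rewrite ?mulr_ge0 ?ler0n ?overlap_ge0. Qed.

Lemma prod_Ccoef_expand I :
  \prod_(i in I) Ccoef U s i = \sum_(f : {ffun 'I_N -> 'I_N}) \prod_i weight I i (f i).
Proof.
rewrite -bigA_distr_bigA big_mkcond /=; apply: eq_bigr => i _.
rewrite /weight; case: ifP => _.
  rewrite /Ccoef exchange_big /= big_mkcond /=; apply: eq_bigr => l _.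
  by case: (l != i); rewrite ?mul1r ?mul0r.
by rewrite (bigD1 i) //= eqxx big1 ?addr0 // => l /negbTE ->.
Qed.

(* For rho with support I, the sum over paths is the term of the expansion
   indexed by rho, the diagonal overlaps being 1. *)
Lemma sum_pair_weight_support I (rho : 'S_N) :
  (forall i, (rho i != i) = (i \in I)) ->
  \sum_(j : {ffun 'I_N -> 'I_M}) pair_weight U s j rho = \prod_i weight I i (rho i).
Proof.
move=> supp_rho; rewrite sum_pair_weight_paths; apply: eq_bigr => i _.
rewrite /weight -supp_rho; case: eqP => [-> | _]; last by rewrite mul1r.
exact: overlap_diag.
Qed.

(* Grouped by support I, the bound is at most prod_(i in I) C_i: the
   permutations with support I inject into the index set of its expansion. *)
Lemma sum_support_le_prod_Ccoef I :
  \sum_(rho : 'S_N | [forall i, (rho i != i) == (i \in I)])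
     \sum_(j : {ffun 'I_N -> 'I_M}) pair_weight U s j rho <=
  \prod_(i in I) Ccoef U s i.
Proof.
set G := fun f : {ffun 'I_N -> 'I_N} => \prod_i weight I i (f i).
rewrite prod_Ccoef_expand -/G.
rewrite (eq_bigr (fun rho : 'S_N => G [ffun i => rho i])) => [|rho /forallP supp_rho].
  apply: (sum_inj_le (P := fun rho : 'S_N => [forall i, (rho i != i) == (i \in I)]))
    => [rho1 rho2 _ _ e | f]; last exact: prodr_ge0 (fun i _ => weight_ge0 _ _ _).
  by apply/permP => i; have := congr1 (fun f : {ffun 'I_N -> 'I_N} => f i) e; rewrite /= !ffunE.
rewrite (sum_pair_weight_support (I := I)) => [|i]; last exact: eqP (supp_rho i).
by apply: eq_bigr => i _; rewrite ffunE.
Qed.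

End Overlaps.

Theorem mainTheorem6 (C : numClosedFieldType) (M N : nat)
  (U : 'M[C]_M) (s : 'I_N -> 'I_M) :
  unitary U -> injective s ->
  let rhs1 := 2^-1 * \sum_(j : {ffun 'I_N -> 'I_M})
                \sum_(rho : 'S_N | rho != 1%g)
                  \prod_(i < N) (`| U (j i) (s i) | * `| U (j i) (s (rho i)) |) in
  let rhs2 := 2^-1 * \sum_(I : {set 'I_N} | I != set0)
                \sum_(rho : 'S_N | [forall i, (rho i != i) == (i \in I)])
                  \sum_(j : {ffun 'I_N -> 'I_M})
                    \prod_(i < N) (`| U (j i) (s i) | * `| U (j i) (s (rho i)) |) in
  [/\ tvd U s <= rhs1, rhs1 = rhs2 &
      tvd U s <= 2^-1 * \sum_(I : {set 'I_N} | I != set0)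
                          \prod_(i in I) Ccoef U s i].
Proof.
move=> unitaryU _ rhs1 rhs2.
have tvd_le1 : tvd U s <= rhs1 := tvd_le_pair_weight U s.
have eq12 : rhs1 = rhs2.
  by rewrite /rhs1 /rhs2 exchange_big /= big_perm_by_support.
split=> //; apply: (le_trans tvd_le1); rewrite eq12.
apply: ler_wpM2l; first by rewrite invr_ge0 ler0n.
by apply: ler_sum => I _; apply: sum_support_le_prod_Ccoef.
Qed.
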